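(* Let $\sigma>0$, let $X$ be a random variable with the Maxwell distribution with scale parameter $\sigma$, and let $F_2$ denote the cumulative distribution function of $X^2$. Then $F_2\in D(\Lambda)$, where $\Lambda(x)=\exp\{-\exp(-x)\}$.
   Context: The Maxwell distribution with scale $\sigma>0$ is the distribution on $(0,\infty)$ with density $f(x)=\sqrt{2/\pi}\,\frac{x^2}{\sigma^3}\exp\left(-\frac{x^2}{2\sigma^2}\right)$, $x>0$. $D(\Lambda)$ denotes the max-domain of attraction of the Gumbel law $\Lambda$: a distribution function $G$ belongs to $D(\Lambda)$ if there are constants $\alpha_n>0$, $\beta_n\in\mathbb{R}$ with $\lim_{n\to\infty}G^n(\alpha_nx+\beta_n)=\Lambda(x)$ for all $x\in\mathbb{R}$. *)

(* Defs.v *)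
From HB Require Import structures.
From mathcomp Require Import all_boot all_order all_algebra.
From mathcomp Require Import all_classical all_reals all_analysis.
From mathcomp Require Import measurable_realfun.
Set Implicit Arguments.
Unset Strict Implicit.
Unset Printing Implicit Defensive.
Import Order.TTheory GRing.Theory Num.Theory.
Import numFieldTopology.Exports numFieldNormedType.Exports.
Local Open Scope classical_set_scope.
Local Open Scope ring_scope.

Section maxwell.
Context {R : realType}.
Variable sigma : R.

Definition maxwell_pdf : R -> R :=
  (fun x => Num.sqrt (2 / pi) * (x ^+ 2 / sigma ^+ 3)
            * expR (- (x ^+ 2 / (2 * sigma ^+ 2)))) \_ `]0, +oo[.

Definition maxwell_prob : set (measurableTypeR R) -> \bar R :=
  fun V => (\int[lebesgue_measure]_(x in V) (maxwell_pdf x)%:E)%E.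

End maxwell.

Definition maxwell_distributed d (T : measurableType d) (R : realType)
    (P : probability T R) (X : {RV P >-> R}) (sigma : R) :=
  forall A : set (measurableTypeR R), measurable A ->
    distribution P X A = maxwell_prob sigma A.

Section square.
Context d (T : measurableType d) (R : realType) (P : probability T R).

Definition sqr_RV (X : {RV P >-> R}) : {RV P >-> R} :=
  (X : {mfun T >-> R}) ^+ 2.

Lemma sqr_RVE (X : {RV P >-> R}) t : sqr_RV X t = X t ^+ 2.
Proof. by rewrite /sqr_RV mfunX. Qed.

End square.

(* [cdf] takes values in the extended reals. *)
Section rcdf.
Context d (T : measurableType d) (R : realType) (P : probability T R).
Variable X : {RV P >-> R}.

Definition rcdf (x : R) : R := fine (cdf X x).

Let cdf_fin x : cdf X x \is a fin_num.
Proof. exact: fin_num_measure. Qed.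

Let rcdf_nondecreasing : nondecreasing_fun rcdf.
Proof. by move=> x y xy; rewrite fine_le//; exact: cdf_nondecreasing. Qed.

Let rcdf_right_continuous : right_continuous rcdf.
Proof.
move=> x; apply: fine_cvg; rewrite fineK//; exact: cdf_right_continuous.
Qed.

HB.instance Definition _ :=
  isCumulative.Build R _ R rcdf rcdf_nondecreasing rcdf_right_continuous.

Let rcdf_cvgNy : rcdf @ -oo --> (0 : R).
Proof. by apply: fine_cvg; exact: cvg_cdfNy0. Qed.

Let rcdf_cvgy : rcdf @ +oo --> (1 : R).
Proof. by apply: fine_cvg; exact: cvg_cdfy1. Qed.

HB.instance Definition _ :=
  isCumulativeBounded.Build R 0 1 rcdf rcdf_cvgNy rcdf_cvgy.

End rcdf.

(* A distribution function on [R] is a [cumulativeBounded 0 1]: nondecreasing,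
   right-continuous, with limits 0 at -oo and 1 at +oo. *)
Definition max_domain (R : realType) (L : R -> R) :
    set (cumulativeBounded (0 : R) (1 : R)) :=
  [set G | exists alpha beta : nat -> R,
     (forall n, 0 < alpha n) /\
     forall x : R, G (alpha n * x + beta n) ^+ n @[n --> \oo] --> L x].

Definition gumbel (R : realType) (x : R) : R := expR (- expR (- x)).

(* Main.v *)
Require Import Defs.
From HB Require Import structures.
From mathcomp Require Import all_boot all_order all_algebra.
From mathcomp Require Import all_classical all_reals all_analysis.
From mathcomp Require Import measurable_realfun ring lra.
Import Order.TTheory GRing.Theory Num.Theory.
Import numFieldTopology.Exports numFieldNormedType.Exports.
Local Open Scope classical_set_scope.
Local Open Scope ring_scope.

(** The number of exceedances of a level by [n] independent copies of [X ^ 2]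
    has mean [n] times the tail of [X ^ 2] at that level; as soon as this mean
    tends to [exp (- x)], the probability [F_2 ^ n] of having no exceedance
    tends to [exp (- exp (- x))] ([cvg_sub1_expn]).  So everything rests on an
    asymptotic equivalent of the tail of [X ^ 2].

    For [r > 0], one has [X ^ 2 > r ^ 2] exactly when [X > r], up to a null
    event, and integration by parts suggests that
    [P (X > r)] is close to
    [h r = sqrt (2 / pi) * (r / sigma) * exp (- r ^ 2 / (2 * sigma ^ 2))].
    Instead of evaluating the integral, the density is trapped between the
    derivatives of [- h] and of [- h * (1 + sigma ^ 2 / r ^ 2)], both of which
    integrate in closed form over a half-line
    ([maxwell_tail_bounds]).  In the variable
    [y = r ^ 2 / (2 * sigma ^ 2)] this says that the tail of [X ^ 2] at
    [2 * sigma ^ 2 * y] is [C * sqrt y * exp (- y)], with [C = 2 / sqrt pi], up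
    to a factor in [[1, 1 + 1 / (2 * y)]] ([ccdf_sqr_maxwell_bounds]).

    Hence the scale is [2 * sigma ^ 2], and the centering, in the variable
    [y], must solve [C * sqrt y * exp (- y) = 1 / n] to first order; with
    [L = ln n] the solution is [L + ln L / 2 + ln C], because the square root
    of [y / L] tends to [1] ([cvgy_maxwell_norming]). *)

(** * Limits *)

(** Squeeze between [exp (- n u)] and [exp (- n u / (1 - u))]: both
    [1 - u <= exp (- u)] and [(1 - u)^-1 <= exp (u / (1 - u))] are instances of
    [1 + v <= exp v]. *)
Lemma cvg_sub1_expn (R : realType) (u : R^nat) (t : R) :
  n%:R * u n @[n --> \oo] --> t -> (1 - u n) ^+ n @[n --> \oo] --> expR (- t).
Proof.
move=> nu_t.
have u0 : u n @[n --> \oo] --> (0 : R).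
  rewrite -(mul0r t).
  have n0 : (n.+1%:R : R)^-1 @[n --> \oo] --> (0 : R) by exact: cvg_harmonic.
  have inv0 : (n%:R : R)^-1 @[n --> \oo] --> (0 : R).
    by rewrite -(cvg_shiftS (fun n => (n%:R : R)^-1)).
  apply: cvg_trans (cvgM inv0 nu_t); apply: near_eq_cvg.
  near=> n; rewrite /= mulKf// pnatr_eq0 -lt0n.
  by near: n; exact: nbhs_infty_gt.
have u1 : \forall n \near \oo, u n < 1 by exact: (cvgr_lt _ u0).
have low : expR (- (n%:R * u n / (1 - u n))) @[n --> \oo] --> expR (- t).
  apply: continuous_cvg; first exact: continuous_expR.
  apply: cvgN; rewrite -[X in _ --> X]divr1; apply: cvgM => //.
  apply: cvgV => //; rewrite -[X in _ --> X]subr0.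
  exact: cvgB (cvg_cst _) u0.
have upp : expR (- (n%:R * u n)) @[n --> \oo] --> expR (- t).
  by apply: continuous_cvg; [exact: continuous_expR|exact: cvgN].
apply: (squeeze_cvgr _ low upp); near=> n.
have un1 : 0 < 1 - u n by rewrite subr_gt0; near: n.
have un0 := ltW un1.
have invE : 1 + u n / (1 - u n) = (1 - u n)^-1 by field; rewrite gt_eqF.
have le_inv : (1 - u n)^-1 <= expR (u n / (1 - u n)).
  by rewrite -[leLHS]invE; exact: expR_ge1Dx.
have le_sub : 1 - u n <= expR (- u n) by exact: expR_ge1Dx.
apply/andP; split.
  have -> : - (n%:R * u n / (1 - u n)) = - (u n / (1 - u n)) * n%:R by ring.
  rewrite expRM_natr lerXn2r ?nnegrE ?expR_ge0//.
  by rewrite expRN -[leRHS]invrK lef_pV2// posrE ?expR_gt0 ?invr_gt0.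
rewrite -mulrN mulrC expRM_natr.
by rewrite lerXn2r ?nnegrE ?expR_ge0.
Unshelve. all: by end_near. Qed.

Lemma cvgy_inv (R : realType) : x^-1 @[x --> +oo] --> (0 : R).
Proof.
apply/gtr0_cvgV0; last exact: cvg_id.
by near=> x; near: x; apply: nbhs_pinfty_gt; rewrite num_real.
Unshelve. all: by end_near. Qed.

(** The quadratic term of the exponential series gives
    [x ^ 2 / 2 <= exp x]. *)
Lemma cvgy_id_expRN (R : realType) : x * expR (- x) @[x --> +oo] --> (0 : R).
Proof.
have inv0 : 2 * x^-1 @[x --> +oo] --> (0 : R).
  by rewrite -[X in _ --> X](mulr0 2); apply: cvgMr; exact: cvgy_inv.
apply: (squeeze_cvgr _ (cvg_cst 0) inv0); near=> x.
have x0 : 0 < x by near: x; apply: nbhs_pinfty_gt; rewrite num_real.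
rewrite mulr_ge0 ?expR_ge0 ?(ltW x0)//= expRN ler_pdivrMr ?expR_gt0//.
have x_ge0 : 0 <= 2 * x^-1 by rewrite divr_ge0// ltW.
have := le_trans _ (expR_ge1Dxn 1 (ltW x0)) => /(_ (x ^+ 2 / 2)).
rewrite ler_wpDl// => /(_ isT)/(ler_wpM2l x_ge0); apply: le_trans.
suff -> : 2 * x^-1 * (x ^+ 2 / 2) = x by [].
by field; rewrite gt_eqF.
Unshelve. all: by end_near. Qed.

Lemma cvgy_ln (R : realType) : @ln R x @[x --> +oo] --> +oo.
Proof.
apply/cvgryPge => M; near=> x.
have x_gt0 : 0 < x by near: x; apply: nbhs_pinfty_gt; rewrite num_real.
by rewrite -(expRK M) ler_ln ?posrE ?expR_gt0.
Unshelve. all: by end_near. Qed.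

Lemma cvgy_ln_div (R : realType) : ln x / x @[x --> +oo] --> (0 : R).
Proof.
have := cvg_comp _ _ (@cvgy_ln R) (@cvgy_id_expRN R).
apply: cvg_trans; apply: near_eq_cvg; near=> x.
rewrite /= expRN lnK// posrE.
by near: x; apply: nbhs_pinfty_gt; rewrite num_real.
Unshelve. all: by end_near. Qed.

(** * Tail of the Maxwell distribution *)

(** Fundamental theorem of calculus on a half-line, for an antiderivative that
    vanishes at infinity. *)
Lemma integral_itvy_derive (R : realType) (f F : R -> R) (a : R) :
  {in `[a, +oo[, forall x, 0 <= f x} ->
  {in `[a, +oo[, forall x : R, is_derive x 1 F (- f x)} ->
  {in `[a, +oo[, continuous f} ->
  F x @[x --> +oo] --> 0 ->
  (\int[lebesgue_measure]_(x in `[a, +oo[) (f x)%:E = (F a)%:E)%E.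
Proof.
move=> f0 dF cf F0.
have dFN x : a <= x -> is_derive x 1 (- F) (f x).
  move=> ax; rewrite -[f x]opprK; apply: is_deriveN.
  by apply: dF; rewrite in_itv/= ax.
rewrite (@ge0_continuous_FTC2y _ f (- F) a 0).
- by rewrite sub0e -EFinN opprK.
- by move=> x ax; apply: f0; rewrite in_itv/= ax.
- by apply: continuous_in_subspaceT => x; rewrite inE; exact: cf.
- by rewrite -oppr0; exact: cvgN.
- by move=> x ax; have [] := dFN x (ltW ax).
- apply: cvg_at_right_filter; apply: differentiable_continuous.
  by apply/derivable1_diffP; have [] := dFN a (lexx a).
- move=> x; rewrite in_itv/= andbT => ax.
  by rewrite derive1E; have [_ ->] := dFN x (ltW ax).
Qed.

Lemma measurable_EFin_itvy (R : realType) (f : R -> R) (a : R) :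
  {in `[a, +oo[, continuous f} ->
  measurable_fun (`[a, +oo[ : set (measurableTypeR R)) (fun x => (f x)%:E).
Proof.
move=> cf; apply/measurable_EFinP; apply: subspace_continuous_measurable_fun.
  exact: measurable_itv.
by apply: continuous_in_subspaceT => x; rewrite inE; exact: cf.
Qed.

Section maxwell_tail.
Variables (R : realType) (s : R).
Hypothesis s_gt0 : 0 < s.
Implicit Types (c : R -> R) (r x y : R).

Definition maxwell_cst : R := Num.sqrt (2 / pi).

Definition gauss_weight x : R := expR (- (x ^+ 2 / (2 * s ^+ 2))).

Definition maxwell_density x : R :=
  maxwell_cst * (x ^+ 2 / s ^+ 3) * gauss_weight x.

(** Boundary term of the integration by parts of [maxwell_density] over
    [[x, +oo[]. *)
Definition maxwell_tail x : R := maxwell_cst * (x / s) * gauss_weight x.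

(** Adds to [maxwell_tail] the Mills upper bound of the remaining Gaussian
    integral. *)
Definition maxwell_tail_ub x : R :=
  maxwell_cst * (x / s + s / x) * gauss_weight x.

Lemma maxwell_cst_gt0 : 0 < maxwell_cst.
Proof. by rewrite sqrtr_gt0 divr_gt0// pi_gt0. Qed.

Lemma maxwell_density_ge0 x : 0 <= maxwell_density x.
Proof.
rewrite mulr_ge0 ?expR_ge0// mulr_ge0 ?(ltW maxwell_cst_gt0)//.
by rewrite divr_ge0 ?sqr_ge0// exprn_ge0// ltW.
Qed.

Lemma is_derive_gauss_weight x :
  is_derive x 1 gauss_weight (- (x / s ^+ 2) * gauss_weight x).
Proof.
rewrite /gauss_weight; apply: is_derive_eq.
by rewrite /GRing.scale/=; field; rewrite gt_eqF.
Qed.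

Lemma is_derive_maxwell_tail x : is_derive x 1 maxwell_tail
  (- (maxwell_cst * (x ^+ 2 / s ^+ 3 - 1 / s) * gauss_weight x)).
Proof.
have ? := is_derive_gauss_weight; rewrite /maxwell_tail.
apply: is_derive_eq.
by rewrite /GRing.scale/=; field; rewrite gt_eqF.
Qed.

Lemma is_derive_maxwell_tail_ub x : 0 < x -> is_derive x 1 maxwell_tail_ub
  (- (maxwell_cst * (x ^+ 2 / s ^+ 3 + s / x ^+ 2) * gauss_weight x)).
Proof.
move=> x0; have ? := is_derive_gauss_weight.
have ? : is_derive x 1 (fun x : R => x^-1) (- x ^- 2 *: 1).
  by apply: is_deriveV; rewrite gt_eqF.
rewrite /maxwell_tail_ub; apply: is_derive_eq.
by rewrite /GRing.scale/=; field; rewrite !gt_eqF.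
Qed.

Lemma maxwell_tail_ubE x : 0 < x ->
  maxwell_tail_ub x = maxwell_tail x * (1 + s ^+ 2 / x ^+ 2).
Proof.
move=> x0; rewrite /maxwell_tail_ub /maxwell_tail.
by field; rewrite !gt_eqF.
Qed.

Lemma maxwell_tail_cvg0 : maxwell_tail x @[x --> +oo] --> 0.
Proof.
have g0 : maxwell_cst * ((x / s) * expR (- (x / s))) @[x --> +oo] --> 0.
  rewrite -[X in _ --> X](mulr0 maxwell_cst); apply: cvgMr.
  apply: (cvg_comp (fun x => x / s) _ _ (@cvgy_id_expRN R)).
  by apply: gt0_cvgMly; [rewrite invr_gt0|exact: cvg_id].
apply: (squeeze_cvgr _ (cvg_cst 0) g0); near=> x.
have x0 : 0 < x by near: x; apply: nbhs_pinfty_gt; rewrite num_real.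
(* from here on the Gaussian exponent dominates [x / s] *)
have xs : 2 * s <= x by near: x; apply: nbhs_pinfty_ge; rewrite num_real.
have K_gt0 := maxwell_cst_gt0.
rewrite /maxwell_tail; apply/andP; split.
  by rewrite !mulr_ge0 ?expR_ge0 ?invr_ge0 ?ltW.
rewrite -mulrA ler_pM2l// ler_pM2l ?divr_gt0// ler_expR lerN2.
rewrite ler_pdivlMr ?mulr_gt0 ?exprn_gt0//.
have -> : x / s * (2 * s ^+ 2) = x * (2 * s) by field; rewrite gt_eqF.
by rewrite expr2 ler_pM2l.
Unshelve. all: by end_near. Qed.

Lemma maxwell_tail_ub_cvg0 : maxwell_tail_ub x @[x --> +oo] --> 0.
Proof.
have g0 : maxwell_tail x * 2 @[x --> +oo] --> 0.
  rewrite -[X in _ --> X](mul0r 2); apply: cvgMl.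
  exact: maxwell_tail_cvg0.
apply: (squeeze_cvgr _ (cvg_cst 0) g0); near=> x.
have x0 : 0 < x by near: x; apply: nbhs_pinfty_gt; rewrite num_real.
have xs : s <= x by near: x; apply: nbhs_pinfty_ge; rewrite num_real.
have tail_gt0 : 0 < maxwell_tail x.
  by rewrite !mulr_gt0 ?expR_gt0 ?invr_gt0 ?maxwell_cst_gt0.
have q_ge0 : 0 <= s ^+ 2 / x ^+ 2 by rewrite divr_ge0 ?sqr_ge0.
rewrite maxwell_tail_ubE// ler_pM2l// mulr_ge0 ?addr_ge0 ?(ltW tail_gt0)//=.
rewrite -[leRHS]/(1 + 1) lerD2l ler_pdivrMr ?exprn_gt0// mul1r.
by rewrite lerXn2r ?nnegrE// ltW.
Unshelve. all: by end_near. Qed.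

Lemma continuous_gaussM c x : {for x, continuous c} ->
  {for x, continuous (fun x => maxwell_cst * c x * gauss_weight x)}.
Proof.
move=> cx; have [/derivable1_diffP dg _] := is_derive_gauss_weight x.
have cg := differentiable_continuous dg.
by apply: cvgM; [exact: cvgMr|exact: cg].
Qed.

Lemma continuous_maxwell_density : continuous maxwell_density.
Proof.
move=> x; apply: (continuous_gaussM (fun x => x ^+ 2 / s ^+ 3)).
by apply: cvgMl; exact: exprn_continuous.
Qed.

(** The density exceeds the opposite of the derivative of [maxwell_tail], and
    is exceeded by that of [maxwell_tail_ub]; beyond [s] the former is
    nonnegative, so that both integrate over [[r, +oo[] to their
    antiderivatives at [r]. *)
Lemma maxwell_tail_bounds r : s <= r ->
  ((maxwell_tail r)%:E
    <= \int[lebesgue_measure]_(x in `[r, +oo[) (maxwell_density x)%:E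
    <= (maxwell_tail_ub r)%:E)%E.
Proof.
move=> sr.
have r0 : 0 < r by apply: lt_le_trans sr.
have rx x : r <= x -> 0 < x by apply: lt_le_trans.
have K_gt0 := maxwell_cst_gt0.
have cX2 x : {for x, continuous (fun x : R => x ^+ 2 / s ^+ 3)}.
  by apply: cvgMl; exact: exprn_continuous.
pose c1 x := x ^+ 2 / s ^+ 3 - 1 / s.
pose c2 x := x ^+ 2 / s ^+ 3 + s / x ^+ 2.
pose f1 x := maxwell_cst * c1 x * gauss_weight x.
pose f2 x := maxwell_cst * c2 x * gauss_weight x.
have cd : {in `[r, +oo[, continuous maxwell_density}.
  by move=> x _; exact: continuous_maxwell_density.
have cf1 : {in `[r, +oo[, continuous f1}.
  move=> x _; apply: (continuous_gaussM c1).
  by apply: cvgB; [exact: cX2|exact: cvg_cst].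
have cf2 : {in `[r, +oo[, continuous f2}.
  move=> x; rewrite in_itv/= andbT => /rx x0; apply: (continuous_gaussM c2).
  apply: cvgD; first exact: cX2.
  by apply: cvgMr; apply: cvgV;
    [rewrite gt_eqF ?exprn_gt0|exact: exprn_continuous].
have f1_ge0 x : r <= x -> 0 <= f1 x.
  move=> rlx; rewrite mulr_ge0 ?expR_ge0// mulr_ge0 ?(ltW K_gt0)//.
  rewrite subr_ge0 ler_pdivlMr ?exprn_gt0//.
  have -> : 1 / s * s ^+ 3 = s ^+ 2 by field; rewrite gt_eqF.
  have sx := le_trans sr rlx.
  by rewrite lerXn2r ?nnegrE// ltW// rx.
have f1_le x : f1 x <= maxwell_density x.
  rewrite ler_pM2r ?expR_gt0// ler_pM2l// gerBl.
  by rewrite divr_ge0// ltW.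
have f2_ge x : r <= x -> maxwell_density x <= f2 x.
  move=> /rx x0; rewrite ler_pM2r ?expR_gt0// ler_pM2l// lerDl.
  by rewrite divr_ge0 ?sqr_ge0// ltW.
rewrite -(integral_itvy_derive _ f1 maxwell_tail); first last.
- exact: maxwell_tail_cvg0.
- exact: cf1.
- by move=> x _; exact: is_derive_maxwell_tail.
- by move=> x; rewrite in_itv/= andbT; exact: f1_ge0.
rewrite -(integral_itvy_derive _ f2 maxwell_tail_ub); first last.
- exact: maxwell_tail_ub_cvg0.
- exact: cf2.
- by move=> x; rewrite in_itv/= andbT => /rx; exact: is_derive_maxwell_tail_ub.
- move=> x; rewrite in_itv/= andbT => rlx.
  exact: le_trans (maxwell_density_ge0 x) (f2_ge _ rlx).
apply/andP; split; apply: ge0_le_integral => //;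
  try exact: measurable_EFin_itvy.
- by move=> x /=; rewrite in_itv/= andbT lee_fin; exact: f1_ge0.
- by move=> x _; rewrite lee_fin.
- by move=> x _; rewrite lee_fin; exact: maxwell_density_ge0.
- by move=> x /=; rewrite in_itv/= andbT lee_fin; exact: f2_ge.
Qed.

(** [maxwell_tail] in the variable [y = x ^ 2 / (2 * s ^ 2)], in which the
    scale disappears. *)
Definition sqr_tail y : R :=
  maxwell_cst * Num.sqrt 2 * (Num.sqrt y * expR (- y)).

Lemma maxwell_tail_sqrt y : 0 <= y ->
  maxwell_tail (s * Num.sqrt (2 * y)) = sqr_tail y.
Proof.
move=> y0; rewrite /maxwell_tail /sqr_tail /gauss_weight.
rewrite exprMn sqr_sqrtr ?mulr_ge0//.
have -> : s ^+ 2 * (2 * y) / (2 * s ^+ 2) = y by field; rewrite gt_eqF.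
by rewrite sqrtrM//; field; rewrite gt_eqF.
Qed.

End maxwell_tail.

(** * Tail of the square *)

Section square_tail.
Context d (T : measurableType d) (R : realType) (P : probability T R).
Variables (X : {RV P >-> R}) (s : R).
Hypothesis X_maxwell : maxwell_distributed X s.
Implicit Types r y : R.

(** The negative part of the event [X ^ 2 > r ^ 2] is discarded by the
    truncation of the density to positive reals. *)
Lemma ccdf_sqr_maxwell r : 0 <= r ->
  ccdf (sqr_RV X) (r ^+ 2) =
  (\int[lebesgue_measure]_(x in `]r, +oo[) (maxwell_density R s x)%:E)%E.
Proof.
move=> r0.
pose A : set (measurableTypeR R) := [set x | r ^+ 2 < x ^+ 2].
have mA : measurable A.
  rewrite (_ : A = (fun x : R => x ^+ 2) @^-1` `]r ^+ 2, +oo[).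
    rewrite -[X in measurable X]setTI.
    exact: (measurable_funX 2 (@measurable_id _ _ setT)).
  by apply/seteqP; split=> x; rewrite /A/= in_itv/= andbT.
transitivity (distribution P X A).
  rewrite /ccdf /distribution/= /pushforward; congr (P _).
  by apply/seteqP; split=> t; rewrite /A/= in_itv/= andbT.
rewrite X_maxwell// /maxwell_prob.
transitivity (\int[lebesgue_measure]_(x in
    A `&` (`]0%R, +oo[ : set (measurableTypeR R)))
    (maxwell_density R s x)%:E)%E.
  rewrite integral_mkcondr; apply: eq_integral => x _.
  by rewrite /maxwell_pdf !patchE; case: ifPn.
congr (integral _ _ _); apply/seteqP; split=> x; rewrite /A/= !in_itv/= !andbT.
  by move=> [rx x0]; rewrite -(ltr_pXn2r (n := 2))// nnegrE ltW.
move=> rx; have x0 : 0 < x by exact: le_lt_trans rx.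
by split=> //; rewrite (ltr_pXn2r (n := 2))// nnegrE ltW.
Qed.

Lemma ccdf_sqr_maxwell_bounds y : 0 < s -> 1 / 2 <= y ->
  sqr_tail R y <= fine (ccdf (sqr_RV X) (2 * s ^+ 2 * y))
    <= sqr_tail R y * (1 + (2 * y)^-1).
Proof.
move=> s_gt0 y_ge.
have y_gt0 : 0 < y by apply: lt_le_trans y_ge.
pose r := s * Num.sqrt (2 * y).
(* the threshold [1 / 2] on [y] is the threshold [s] on [r] *)
have r_ge : s <= r.
  rewrite ler_peMr ?(ltW s_gt0)// -[leLHS]sqrtr1 ler_sqrt; lra.
have r2E : r ^+ 2 = 2 * s ^+ 2 * y.
  by rewrite exprMn sqr_sqrtr ?mulr_ge0 ?(ltW y_gt0)//; ring.
have r_gt0 : 0 < r by apply: lt_le_trans r_ge.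
have tailE : maxwell_tail R s r = sqr_tail R y.
  exact: maxwell_tail_sqrt (ltW y_gt0).
have ubE : maxwell_tail_ub R s r = sqr_tail R y * (1 + (2 * y)^-1).
  rewrite maxwell_tail_ubE// tailE r2E; congr (_ * (1 + _)).
  by field; rewrite !gt_eqF.
have := maxwell_tail_bounds R s s_gt0 r r_ge.
rewrite -integral_itv_obnd_cbnd; last first.
  apply: measurable_funS (measurable_EFin_itvy _ _ r _).
  - exact: measurable_itv.
  - by apply: subset_itvr; rewrite bnd_simp.
  - move=> x _; exact: continuous_maxwell_density.
rewrite -ccdf_sqr_maxwell ?(ltW r_gt0)// r2E tailE ubE.
have : ccdf (sqr_RV X) (2 * s ^+ 2 * y) \is a fin_num by exact: fin_num_measure.
by move=> /fineK <-; rewrite !lee_fin.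
Qed.

End square_tail.

Lemma rcdf_ccdf d (T : measurableType d) (R : realType)
    (P : probability T R) (X : {RV P >-> R}) (x : R) :
  rcdf X x = 1 - fine (ccdf X x).
Proof.
by rewrite /rcdf cdf_1_ccdf fineB// fin_num_measure.
Qed.

(** * Norming constants *)

(** Writing [y] for the argument of the square root, [exp L * exp (- y)] is
    [exp (- k) * exp (- x) / sqrt L], and [y / L] tends to [1]. *)
Lemma cvgy_maxwell_norming (R : realType) (k x : R) :
  let y L := L + ln L / 2 + k + x in
  expR L * (Num.sqrt (y L) * expR (- y L)) @[L --> +oo] -->
  expR (- k) * expR (- x).
Proof.
move=> y.
have y1 : y L / L @[L --> +oo] --> (1 : R).
  have i0 : (k + x) * L^-1 @[L --> +oo] --> (0 : R).
    rewrite -[X in _ --> X](mulr0 (k + x)); apply: cvgMr.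
    exact: cvgy_inv.
  have l0 : ln L / L / 2 @[L --> +oo] --> (0 : R).
    by rewrite -[X in _ --> X](mul0r 2^-1); apply: cvgMl; exact: cvgy_ln_div.
  have : 1 + ln L / L / 2 + (k + x) * L^-1 @[L --> +oo] --> (1 : R).
    rewrite -[X in _ --> X]addr0; apply: cvgD i0.
    by rewrite -[X in _ --> X]addr0; apply: cvgD l0; exact: cvg_cst.
  apply: cvg_trans; apply: near_eq_cvg; near=> L.
  have L0 : 0 < L by near: L; apply: nbhs_pinfty_gt; rewrite num_real.
  by rewrite /y/=; field; rewrite gt_eqF.
have : Num.sqrt (y L / L) * (expR (- k) * expR (- x)) @[L --> +oo] -->
    expR (- k) * expR (- x).
  rewrite -[X in _ --> X]mul1r; apply: cvgMl; rewrite -[X in _ --> X]sqrtr1.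
  by apply: continuous_cvg => //; exact: sqrt_continuous.
apply: cvg_trans; apply: near_eq_cvg; near=> L.
have L0 : 0 < L by near: L; apply: nbhs_pinfty_gt; rewrite num_real.
have eL : expR (ln L / 2) = Num.sqrt L.
  rewrite -(@ger0_norm _ (expR _)) ?expR_ge0// -sqrtr_sqr -expRM_natr.
  by rewrite divfK ?lnK ?posrE.
have -> : Num.sqrt (y L / L) = Num.sqrt (y L) / Num.sqrt L.
  by rewrite mulrC sqrtrM ?invr_ge0 ?(ltW L0)// sqrtrV ?(ltW L0)// mulrC.
have -> : expR (- y L) = expR (- L) / Num.sqrt L * expR (- k) * expR (- x).
  by rewrite /y !opprD !expRD [expR (- (_ / 2))]expRN eL.
have -> : expR (- L) = (expR L)^-1 by rewrite expRN.
by field; rewrite !gt_eqF ?expR_gt0 ?sqrtr_gt0.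
Unshelve. all: by end_near. Qed.

Lemma cvgy_maxwell_level (R : realType) (k x : R) :
  L + ln L / 2 + k + x @[L --> +oo] --> +oo.
Proof.
apply/cvgryPge => M; near=> L.
have L1 : 1 <= L by near: L; apply: nbhs_pinfty_ge; rewrite num_real.
have ML : M - k - x <= L by near: L; apply: nbhs_pinfty_ge; rewrite num_real.
by have := ln_ge0 L1; lra.
Unshelve. all: by end_near. Qed.

Theorem proposition2p2 (R : realType) (d : measure_display)
    (T : measurableType d) (P : probability T R) (X : {RV P >-> R})
    (sigma : R) (sigma_gt0 : 0 < sigma)
    (X_maxwell : maxwell_distributed X sigma) :
  max_domain (@gumbel R) (rcdf (sqr_RV X)).
Proof.
pose C : R := maxwell_cst R * Num.sqrt 2.
have C_gt0 : 0 < C by rewrite mulr_gt0 ?maxwell_cst_gt0 ?sqrtr_gt0.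
pose b (L : R) := L + ln L / 2 + ln C.
exists (fun=> 2 * sigma ^+ 2), (fun n => 2 * sigma ^+ 2 * b (ln n%:R)).
split=> [_|x]; first by rewrite mulr_gt0// exprn_gt0.
have ln_oo : ln n%:R @[n --> \oo] --> (+oo : set_system R).
  exact: cvg_comp (@cvgr_idn R) (@cvgy_ln R).
pose y (n : nat) := b (ln n%:R) + x.
have y_oo : y n @[n --> \oo] --> +oo.
  exact: cvg_comp ln_oo (@cvgy_maxwell_level R (ln C) x).
pose u (n : nat) := fine (ccdf (sqr_RV X) (2 * sigma ^+ 2 * y n)).
pose t (n : nat) := sqr_tail R (y n).
have t_lim : n%:R * t n @[n --> \oo] --> expR (- x).
  have := cvg_comp _ _ ln_oo (@cvgy_maxwell_norming R (ln C) x).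
  move=> /(cvgMr (a := C)).
  rewrite mulrA expRN lnK ?posrE// divff ?gt_eqF// mul1r.
  apply: cvg_trans; apply: near_eq_cvg; near=> n.
  have n_gt0 : 0 < n%:R :> R by rewrite ltr0n; near: n; exact: nbhs_infty_gt.
  by rewrite /= lnK ?posrE// /t mulrCA.
have u_lim : n%:R * u n @[n --> \oo] --> expR (- x).
  have ub_lim : n%:R * t n * (1 + 2^-1 * (y n)^-1) @[n --> \oo] --> expR (- x).
    rewrite -[X in _ --> X]mulr1; apply: cvgM => //.
    rewrite -[X in _ --> X]addr0; apply: cvgD; first exact: cvg_cst.
    rewrite -[X in _ --> X](mulr0 2^-1); apply: cvgMr.
    exact: cvg_comp y_oo (@cvgy_inv R).
  apply: (squeeze_cvgr _ t_lim ub_lim); near=> n.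
  have y_ge : 1 / 2 <= y n.
    by near: n; move/cvgryPge: y_oo; apply.
  have /andP[tu ut] :=
    ccdf_sqr_maxwell_bounds _ _ _ _ _ _ X_maxwell _ sigma_gt0 y_ge.
  by rewrite ler_wpM2l//= -mulrA ler_wpM2l// -invfM.
have := cvg_sub1_expn R u (expR (- x)) u_lim.
apply: cvg_trans; apply: near_eq_cvg; near=> n.
by rewrite /= rcdf_ccdf /u /y -mulrDr [x + _]addrC.
Unshelve. all: by end_near. Qed.
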